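(* Let $m\ge n\ge0$ be integers, $\beta>-1$, $\gamma>-1$. Write $M^{(\beta,\gamma)}_{m,n}$ for $M^{(\beta,\gamma)}_{m,n}(z_1,z_2)$. Then $$\frac{\partial}{\partial z_2}M_{m,n}^{(\beta,\gamma)}=-(\beta+\gamma+m+1)M_{m,n-1}^{(\beta+1,\gamma)},$$ $$\delta_{z_2}M_{m,n}^{(\beta,\gamma)}=nM_{m,n}^{(\beta,\gamma)}-(\gamma+m)M_{m-1,n-1}^{(\beta+1,\gamma)}=(\beta+\gamma+m+1)\big(M_{m,n}^{(\beta+1,\gamma)}-M_{m,n}^{(\beta,\gamma)}\big),$$ $$\delta_{z_1}M_{m,n}^{(\beta,\gamma)}=mM_{m,n}^{(\beta,\gamma)}-(\gamma+m)M_{m-1,n-1}^{(\beta+1,\gamma)}=(\beta+\gamma+m+1)M_{m,n}^{(\beta+1,\gamma)}-(\beta+\gamma+n+1)M_{m,n}^{(\beta,\gamma)},$$ $$(\beta+\gamma+m+1)\delta_{z_1}M_{m,n}^{(\beta,\gamma)}-(\beta+\gamma+n+1)\delta_{z_2}M_{m,n}^{(\beta,\gamma)}=(m-n)(\beta+\gamma+m+1)M_{m,n}^{(\beta+1,\gamma)},$$ $$(\delta_{z_1}-\delta_{z_2})M_{m,n}^{(\beta,\gamma)}=(m-n)M_{m,n}^{(\beta,\gamma)}.$$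
   Context: For $\beta,\gamma>-1$ and integers $m\ge n\ge0$, $$M_{m,n}^{(\beta,\gamma)}(z_1,z_2)=\sum_{k=0}^n\frac{(m+\beta+\gamma+1)_{n-k}(\gamma+1)_m\,z_1^{m-k}(-z_2)^{n-k}}{k!\,(n-k)!\,(\gamma+1)_{m-k}},$$ and $M_{m,n}^{(\beta,\gamma)}(z_1,z_2)=M_{n,m}^{(\beta,\gamma)}(z_2,z_1)$ for $m<n$; terms with a negative index are $0$. $(a)_k=a(a+1)\cdots(a+k-1)$ and $\delta_{z_j}=z_j\,\partial/\partial z_j$, with $z_1,z_2$ treated as independent variables. *)

(* Defs.v *)
From mathcomp Require Import all_boot all_order all_algebra.
From mathcomp Require Import complex.
From mathcomp Require Import boolp classical_sets reals topology normedtype derive.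

Set Implicit Arguments.
Unset Strict Implicit.
Unset Printing Implicit Defensive.

Import Order.TTheory GRing.Theory Num.Theory.
Import numFieldNormedType.Exports.

Local Open Scope ring_scope.
Local Open Scope complex_scope.
Local Open Scope classical_set_scope.

(* The shifted factorial (a)_k = a (a + 1) ... (a + k - 1). *)
Definition poch (R : pzRingType) (a : R) (k : nat) : R :=
  \prod_(i < k) (a + i%:R).

(* The explicit sum defining M_{m,n}; it is only meant for n <= m, where the truncated
   subtractions m - k and n - k (k <= n) are genuine ones. *)
Definition zernike_sum (R : realType) (beta gamma : R) (m n : nat)
    (z1 z2 : R[i]) : R[i] :=
  \sum_(k < n.+1)
    (poch (m%:R + beta + gamma + 1) (n - k) * poch (gamma + 1) m
       / (k`!%:R * (n - k)`!%:R * poch (gamma + 1) (m - k)))%:C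
    * z1 ^+ (m - k) * (- z2) ^+ (n - k).

(* M_{m,n}^{(beta,gamma)}(z1, z2): symmetric extension to m < n, and 0 as soon
   as an index is negative. *)
Definition zernike (R : realType) (beta gamma : R) (m n : int)
    (z1 z2 : R[i]) : R[i] :=
  match m, n with
  | Posz m', Posz n' =>
      if (n' <= m')%N then zernike_sum beta gamma m' n' z1 z2
      else zernike_sum beta gamma n' m' z2 z1
  | _, _ => 0
  end.

(* Complex partial derivatives, z1 and z2 being independent variables.  The
   derivative derive1 is total, hence the separate differentiability
   predicates; R[i]^o is R[i] as a normed module over itself. *)
Section PartialDerivatives.
Variable R : realType.
Implicit Type F : R[i] -> R[i] -> R[i].

Definition derivable_z1 F (z1 z2 : R[i]) : Prop :=
  derivable ((fun w => F w z2) : R[i]^o -> R[i]^o) z1 1.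

Definition derivable_z2 F (z1 z2 : R[i]) : Prop :=
  derivable ((fun w => F z1 w) : R[i]^o -> R[i]^o) z2 1.

Definition partial_z1 F (z1 z2 : R[i]) : R[i] :=
  derive1 ((fun w => F w z2) : R[i] -> R[i]^o) z1.

Definition partial_z2 F (z1 z2 : R[i]) : R[i] :=
  derive1 ((fun w => F z1 w) : R[i] -> R[i]^o) z2.

Definition delta_z1 F (z1 z2 : R[i]) : R[i] := z1 * partial_z1 F z1 z2.

Definition delta_z2 F (z1 z2 : R[i]) : R[i] := z2 * partial_z2 F z1 z2.

End PartialDerivatives.

(* Main.v *)
Require Import Defs.
From mathcomp Require Import all_boot all_order all_algebra.
From mathcomp Require Import complex ring.
From mathcomp Require Import functions.
From mathcomp Require Import boolp classical_sets reals topology normedtype derive.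

Set Implicit Arguments.
Unset Strict Implicit.
Unset Printing Implicit Defensive.

Import Order.TTheory GRing.Theory Num.Theory.

Local Open Scope ring_scope.
Local Open Scope complex_scope.

(** The polynomial M_{m,n} is a combination of the monomials
    z1^(m-k) (-z2)^(n-k), each of which is an eigenvector of both Euler
    operators, with eigenvalues m - k and n - k.  Hence delta_{z1} M = m M - K
    and delta_{z2} M = n M - K with one and the same defect
    K = sum_k k (k-th term of M) [delta_z1_zernike_sum, delta_z2_zernike_sum],
    and the last identity follows by subtraction.

    The others compare coefficients, writing a = m + beta + gamma + 1 for the
    base of the shifted factorial containing beta; replacing beta by beta + 1
    replaces a by a + 1.
    - a (a+1)_N = (a)_(N+1) gives the z2-derivative [zernike_coef_pred_n].
    - k / k! = 1 / (k-1)! and (gamma+1)_m = (gamma+1)_(m-1) (gamma+m) identify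
      K with (gamma + m) M_{m-1,n-1}^{(beta+1,gamma)} [zernike_defect]: lowering
      m while raising beta leaves a unchanged.
    - a (a+1)_N = (a)_N (a+N) with N = n - k turns the eigenvalue N of
      delta_{z2} into a shift of beta [zernike_coef_shift].
    The identities for delta_{z1} and for the mixed combination are then linear
    consequences, since the two scalars cm and cn differ by m - n. *)

(** * Shifted factorials and coefficients *)

Lemma pochSr (R : pzRingType) (a : R) n :
  poch a n.+1 = poch a n * (a + n%:R).
Proof. by rewrite /poch big_ord_recr. Qed.

Lemma pochSl (R : pzRingType) (a : R) n : poch a n.+1 = a * poch (a + 1) n.
Proof.
rewrite /poch big_ord_recl addr0; congr (_ * _).
by apply: eq_bigr => i _; rewrite /= -addrA -natr1 [1 + _]addrC.
Qed.

Definition zernike_coef (R : realType) (beta gamma : R) (m n k : nat) : R :=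
  poch (m%:R + beta + gamma + 1) (n - k) * poch (gamma + 1) m
    / (k`!%:R * (n - k)`!%:R * poch (gamma + 1) (m - k)).

Section Coefficients.
Variables (R : realType) (beta gamma : R).

Lemma zernike_coef_pred_n (m n k : nat) : (k <= n)%N ->
  (n.+1 - k)%:R * zernike_coef beta gamma m n.+1 k
  = (beta + gamma + m%:R + 1) * zernike_coef (beta + 1) gamma m n k.
Proof.
move=> le_kn; rewrite /zernike_coef subSn // factS natrM !invfM pochSl.
have -> : m%:R + beta + gamma + 1 + 1 = m%:R + (beta + 1) + gamma + 1 by ring.
(* The factor 1 / (gamma + 1)_(m - k) is common to both sides: as an atom r it
   contributes no nonvanishing condition, and only factorials are cleared. *)
set p := poch _ (n - k); set q := poch _ m; set r := (poch _ _)^-1.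
by field; rewrite nat1r !pnatr_eq0 -!lt0n !fact_gt0.
Qed.

Lemma zernike_coef_pred_k (m n k : nat) :
  k.+1%:R * zernike_coef beta gamma m.+1 n.+1 k.+1
  = (gamma + m.+1%:R) * zernike_coef (beta + 1) gamma m n k.
Proof.
rewrite /zernike_coef !subSS factS natrM !invfM pochSr.
have -> : m.+1%:R + beta + gamma + 1 = m%:R + (beta + 1) + gamma + 1.
  by rewrite -natr1; ring.
set p := poch _ (n - k); set q := poch _ m; set r := (poch _ _)^-1.
by field; rewrite nat1r !pnatr_eq0 -!lt0n !fact_gt0.
Qed.

(** With a = m + beta + gamma + 1 and N = n - k, both a (a+1)_N and (a)_N (a+N)
    are (a)_(N+1), so N (a)_N = a ((a+1)_N - (a)_N). *)
Lemma zernike_coef_shift (m n k : nat) :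
  (n - k)%:R * zernike_coef beta gamma m n k
  = (beta + gamma + m%:R + 1)
    * (zernike_coef (beta + 1) gamma m n k - zernike_coef beta gamma m n k).
Proof.
rewrite /zernike_coef.
have -> : m%:R + (beta + 1) + gamma + 1 = m%:R + beta + gamma + 1 + 1 by ring.
set a := m%:R + beta + gamma + 1.
have -> : beta + gamma + m%:R + 1 = a by rewrite /a; ring.
have := pochSl a (n - k); rewrite pochSr => pochE.
rewrite -mulrBl -mulrBl !mulrA; congr (_ * _ * _).
by rewrite mulrBr -pochE; ring.
Qed.

End Coefficients.

(** * Derivatives of the sum *)

(** The inner function f covers both variables at once: it is the identity for
    z1 and the opposite for z2. *)
Lemma is_derive_sum_powers (K : numFieldType) n (a : 'I_n -> K)
    (e : 'I_n -> nat) (f : K^o -> K^o) (x df : K^o) :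
  is_derive x (1 : K^o) f df ->
  is_derive x (1 : K^o) ((fun w => \sum_(i < n) a i * f w ^+ e i) : K^o -> K^o)
    (\sum_(i < n) a i * ((e i)%:R * f x ^+ (e i).-1 * df)).
Proof.
move=> fx.
have -> : (fun w => \sum_(i < n) a i * f w ^+ e i)
    = \sum_(i < n) ((a i : K) *: ((f ^+ e i) : K^o -> K^o)).
  apply/funext => w; rewrite fct_sumE; apply: eq_bigr => i _.
  by rewrite scalrfctE exprfctE.
by apply: is_derive_sum => i; apply: is_deriveZ; apply: is_deriveX.
Qed.

Lemma mulr_pow_pred (K : comNzRingType) (x : K) e :
  x * (e%:R * x ^+ e.-1) = e%:R * x ^+ e.
Proof. by case: e => [|e]; rewrite ?mul0r ?mulr0 //= mulrCA -exprS. Qed.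

Lemma natr_mulC (R : realType) k (x : R) : k%:R * x%:C = (k%:R * x)%:C.
Proof. by rewrite rmorphM rmorph_nat. Qed.

Section Derivatives.
Variables (R : realType) (beta gamma : R) (m n : nat) (z1 z2 : R[i]).

Local Notation coef k := ((zernike_coef beta gamma m n k)%:C).
Local Notation term k := (coef k * z1 ^+ (m - k) * (- z2) ^+ (n - k)).

Lemma is_derive_z1_zernike_sum :
  is_derive (z1 : R[i]^o) (1 : R[i]^o)
    ((fun w => zernike_sum beta gamma m n w z2) : R[i]^o -> R[i]^o)
    (\sum_(k < n.+1) coef k * (- z2) ^+ (n - k)
        * ((m - k)%:R * z1 ^+ (m - k).-1 * 1)).
Proof.
have -> : (fun w => zernike_sum beta gamma m n w z2)
    = (fun w => \sum_(k < n.+1) (coef k * (- z2) ^+ (n - k)) * w ^+ (m - k)).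
  by apply/funext => w; apply: eq_bigr => k _; rewrite mulrAC.
exact: (@is_derive_sum_powers _ _ (fun k : 'I_n.+1 => coef k * (- z2) ^+ (n - k))
  (fun k : 'I_n.+1 => (m - k)%N) id).
Qed.

Lemma is_derive_z2_zernike_sum :
  is_derive (z2 : R[i]^o) (1 : R[i]^o)
    ((fun w => zernike_sum beta gamma m n z1 w) : R[i]^o -> R[i]^o)
    (\sum_(k < n.+1) coef k * z1 ^+ (m - k)
        * ((n - k)%:R * (- z2) ^+ (n - k).-1 * -1)).
Proof.
exact: (@is_derive_sum_powers _ _ (fun k : 'I_n.+1 => coef k * z1 ^+ (m - k))
  (fun k : 'I_n.+1 => (n - k)%N) -%R).
Qed.

Lemma partial_z2_zernike_sum :
  partial_z2 (zernike_sum beta gamma m n) z1 z2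
  = - \sum_(k < n.+1) coef k * z1 ^+ (m - k)
        * ((n - k)%:R * (- z2) ^+ (n - k).-1).
Proof.
rewrite /partial_z2 derive1E.
rewrite (@derive_val _ _ _ _ _ _ _ is_derive_z2_zernike_sum) -sumrN.
by apply: eq_bigr => k _; rewrite mulrN1 mulrN.
Qed.

Lemma delta_z1_zernike_sum : (n <= m)%N ->
  delta_z1 (zernike_sum beta gamma m n) z1 z2
  = m%:R * zernike_sum beta gamma m n z1 z2 - \sum_(k < n.+1) k%:R * term k.
Proof.
move=> le_nm; rewrite /delta_z1 /partial_z1 derive1E.
rewrite (@derive_val _ _ _ _ _ _ _ is_derive_z1_zernike_sum).
rewrite !mulr_sumr -sumrB; apply: eq_bigr => k _.
have le_km : (k <= m)%N by rewrite (leq_trans _ le_nm) // -ltnS.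
rewrite mulr1 mulrCA mulr_pow_pred natrB // -/(zernike_coef _ _ _ _ _).
by ring.
Qed.

Lemma delta_z2_zernike_sum :
  delta_z2 (zernike_sum beta gamma m n) z1 z2
  = n%:R * zernike_sum beta gamma m n z1 z2 - \sum_(k < n.+1) k%:R * term k.
Proof.
rewrite /delta_z2 partial_z2_zernike_sum mulrN -mulNr.
rewrite !mulr_sumr -sumrB; apply: eq_bigr => k _.
have le_kn : (k <= n)%N by rewrite -ltnS.
rewrite mulrCA mulr_pow_pred natrB // -/(zernike_coef _ _ _ _ _).
by ring.
Qed.

(** The Euler operator in z2 gives the eigenvalue n - k, which
    [zernike_coef_shift] trades for a shift of beta. *)
Lemma delta_z2_zernike_shift :
  delta_z2 (zernike_sum beta gamma m n) z1 z2
  = (beta + gamma + m%:R + 1)%:C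
    * (zernike_sum (beta + 1) gamma m n z1 z2 - zernike_sum beta gamma m n z1 z2).
Proof.
rewrite delta_z2_zernike_sum -sumrB !mulr_sumr -sumrB.
apply: eq_bigr => k _; rewrite -!/(zernike_coef _ _ _ _ _).
have le_kn : (k <= n)%N by rewrite -ltnS.
rewrite -mulrBl -!mulrBl !mulrA -natrB //; congr (_ * _ * _).
by rewrite -rmorphB -rmorphM -zernike_coef_shift natr_mulC.
Qed.

End Derivatives.

(** * The functions with integer indices *)

Lemma zernike_natE (R : realType) (beta gamma : R) (m n : nat) : (n <= m)%N ->
  zernike beta gamma m n = zernike_sum beta gamma m n.
Proof. by move=> le_nm; rewrite /zernike le_nm. Qed.

Lemma zernike_n_neg (R : realType) (beta gamma : R) (m : int) :
  zernike beta gamma m (0 - 1) = fun=> fun=> 0.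
Proof. by case: m. Qed.

Lemma succz_sub1 (n : nat) : n.+1%:Z - 1 = n%:Z.
Proof. by rewrite intS addrAC subrr add0r. Qed.

Section IntegerIndices.
Variables (R : realType) (beta gamma : R) (z1 z2 : R[i]).

(** The k = 0 term vanishes because of the factor k, and the remaining ones are
    reindexed by k - 1.  For n = 0 nothing remains, in agreement with the value
    0 at a negative index. *)
Lemma zernike_defect (m n : nat) : (n <= m)%N ->
  \sum_(k < n.+1) k%:R * ((zernike_coef beta gamma m n k)%:C
      * z1 ^+ (m - k) * (- z2) ^+ (n - k))
  = (gamma + m%:R)%:C * zernike (beta + 1) gamma (m%:Z - 1) (n%:Z - 1) z1 z2.
Proof.
case: n => [|n]; first by rewrite big_ord1 mul0r zernike_n_neg mulr0.
case: m => // m le_nm; rewrite !succz_sub1 zernike_natE //.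
rewrite big_ord_recl mul0r add0r mulr_sumr; apply: eq_bigr => k _.
rewrite /= -/(zernike_coef _ _ _ _ _) /bump add1n !subSS !mulrA.
congr (_ * _ * _).
by rewrite natr_mulC -rmorphM -zernike_coef_pred_k.
Qed.

(** The k = n term is constant in z2, which is why the derivative stops at
    k = n - 1. *)
Lemma partial_z2_zernike (m n : nat) : (n <= m)%N ->
  partial_z2 (zernike_sum beta gamma m n) z1 z2
  = - (beta + gamma + m%:R + 1)%:C * zernike (beta + 1) gamma m (n%:Z - 1) z1 z2.
Proof.
move=> le_nm; rewrite partial_z2_zernike_sum mulNr; congr (- _).
case: n le_nm => [|n] le_nm.
  by rewrite big_ord1 mul0r mulr0 zernike_n_neg mulr0.
rewrite succz_sub1 zernike_natE ?(ltnW le_nm) //.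
rewrite big_ord_recr /= subnn mul0r mulr0 addr0 mulr_sumr.
apply: eq_bigr => k _; rewrite -/(zernike_coef _ _ _ _ _).
have le_kn : (k <= n)%N by rewrite -ltnS.
rewrite !mulrA -rmorphM -zernike_coef_pred_n //= -natr_mulC subSn //=.
by ring.
Qed.

End IntegerIndices.

Theorem theorem4p1 (R : realType) (m n : int) (beta gamma : R) (z1 z2 : R[i])
    (hn : 0 <= n) (hmn : n <= m) (hbeta : -1 < beta) (hgamma : -1 < gamma) :
  let M := zernike beta gamma m n in
  let Mb := zernike (beta + 1) gamma m n in
  let Mb_n1 := zernike (beta + 1) gamma m (n - 1) in
  let Mb_m1n1 := zernike (beta + 1) gamma (m - 1) (n - 1) in
  let cm := (beta + gamma + m%:~R + 1)%:C in
  let cn := (beta + gamma + n%:~R + 1)%:C in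
  (derivable_z1 M z1 z2 /\ derivable_z2 M z1 z2) /\
  (partial_z2 M z1 z2 = - cm * Mb_n1 z1 z2) /\
  (delta_z2 M z1 z2 = n%:~R * M z1 z2 - (gamma + m%:~R)%:C * Mb_m1n1 z1 z2 /\
   delta_z2 M z1 z2 = cm * (Mb z1 z2 - M z1 z2)) /\
  (delta_z1 M z1 z2 = m%:~R * M z1 z2 - (gamma + m%:~R)%:C * Mb_m1n1 z1 z2 /\
   delta_z1 M z1 z2 = cm * Mb z1 z2 - cn * M z1 z2) /\
  (cm * delta_z1 M z1 z2 - cn * delta_z2 M z1 z2
     = (m - n)%:~R * cm * Mb z1 z2) /\
  (delta_z1 M z1 z2 - delta_z2 M z1 z2 = (m - n)%:~R * M z1 z2).
Proof.
case: n hn hmn => // n _; case: m => // m; rewrite lez_nat => le_nm.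
move=> M Mb Mb_n1 Mb_m1n1 cm cn.
have ME : M = zernike_sum beta gamma m n by exact: zernike_natE.
have MbE : Mb = zernike_sum (beta + 1) gamma m n by exact: zernike_natE.
have d2_lower : delta_z2 M z1 z2
    = n%:R * M z1 z2 - (gamma + m%:R)%:C * Mb_m1n1 z1 z2.
  by rewrite ME delta_z2_zernike_sum zernike_defect.
have d1_lower : delta_z1 M z1 z2
    = m%:R * M z1 z2 - (gamma + m%:R)%:C * Mb_m1n1 z1 z2.
  by rewrite ME delta_z1_zernike_sum // zernike_defect.
have d2_shift : delta_z2 M z1 z2 = cm * (Mb z1 z2 - M z1 z2).
  by rewrite ME MbE delta_z2_zernike_shift.
have d1_d2 : delta_z1 M z1 z2 = delta_z2 M z1 z2 + (m%:R - n%:R) * M z1 z2.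
  by rewrite d1_lower d2_lower; ring.
have cmE : cm = cn + (m%:R - n%:R).
  rewrite -!(rmorph_nat (real_complex R)) -rmorphB -rmorphD; congr (_%:C).
  by rewrite !pmulrn; ring.
have mnE : (m%:Z - n%:Z)%:~R = m%:R - n%:R :> R[i] by rewrite rmorphB.
do ![split] => //.
- by rewrite ME; exact: (@ex_derive _ _ _ _ _ _ _ (is_derive_z1_zernike_sum _ _ _ _ _ _)).
- by rewrite ME; exact: (@ex_derive _ _ _ _ _ _ _ (is_derive_z2_zernike_sum _ _ _ _ _ _)).
- by rewrite ME partial_z2_zernike.
- by rewrite d1_d2 d2_shift cmE; ring.
- by rewrite d1_d2 d2_shift mnE cmE; ring.
- by rewrite d1_d2 mnE; ring.
Qed.
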